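(* Let $X$ be a finite set and $F$ the free group on $X$. Let $\Gamma$ be a finite $X$-labelled graph that is an immersion, let $\Gamma^+$ be any covering expansion of $\Gamma$, and let $G$ be the group of deck transformations of $\Gamma^+$ (in the sense defined in the context). Let $H$ be a finite group generated by $X$, and let $\phi:H\to G$ be a group homomorphism such that $[w]_G=\phi([w]_H)$ for each $w\in F$. Let $\eta$ and $\eta'$ be reduced paths in the Cayley graph $\mathcal{C}(H)$ such that $\alpha(\eta)=\alpha(\eta')$, and suppose that each geometric edge traversed by $\eta$ is also traversed by $\eta'$. Then for any reduced path $\gamma'$ in $\Gamma$ such that $\ell(\gamma')=\ell(\eta')$, there is a path $\gamma$ in $\Gamma$ such that $\ell(\gamma)=\ell(\eta)$ and $\alpha(\gamma)=\alpha(\gamma')$; if in addition $\omega(\eta)=\omega(\eta')$, then $\omega(\gamma)=\omega(\gamma')$.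
   Context: Graphs are in the sense of Serre: each edge $e$ has an initial vertex $\alpha(e)$, a terminal vertex $\omega(e)$, and a reverse edge $\bar e\neq e$ with $\bar{\bar e}=e$, $\alpha(\bar e)=\omega(e)$, $\omega(\bar e)=\alpha(e)$. A geometric edge is a pair $\{e,\bar e\}$; a path traverses it if $e$ or $\bar e$ occurs in the path. An $X$-labelled graph has a label $\ell(e)\in X\sqcup X^{-1}$ on each edge $e$, with $\ell(\bar e)=\ell(e)^{-1}$. For a path $\gamma$, $\alpha(\gamma)$, $\omega(\gamma)$ and $\ell(\gamma)$ denote its initial vertex, its terminal vertex and its label (the word formed by the labels of its edges in order). A path is reduced if it contains no consecutive edges $e,\bar e$. An $X$-labelled graph (not necessarily connected) is an immersion (resp. covering) if for each vertex $v$ and each $a\in X\sqcup X^{-1}$ there is at most one (resp. exactly one) edge with initial vertex $v$ and label $a$. A covering expansion of an immersion $\Gamma$ is a finite $X$-labelled graph $\Gamma^+$ that is a covering and contains $\Gamma$ as a labelled subgraph. A group generated by $X$ is a group $K$ together with a fixed surjective homomorphism $F\to K$; the image of $w\in F$ (or of a word $w$ in $X\sqcup X^{-1}$) is denoted $[w]_K$. The Cayley graph $\mathcal{C}(K)$ is the $X$-labelled graph with vertex set $K$ and, for each $g\in K$ and $x\in X$, an edge labelled $x$ from $g$ to $g[x]_K$ (together with its reverse, labelled $x^{-1}$). Group of deck transformations: if $\Delta$ is a finite covering with vertex set $V$, then $F$ acts on $V$ on the right, where $u\cdot w$ is the terminal vertex of the unique path in $\Delta$ starting at $u$ with label $w$.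 The ''group of deck transformations'' of $\Delta$ is the group of permutations of $V$ induced by this action (composed as right actions), i.e. the quotient of $F$ by the kernel of the action, regarded as a group generated by $X$ through this quotient map. *)

(* Defs.v *)
From HB Require Import structures.
From mathcomp Require Import all_boot all_fingroup.
From mathcomp Require Import boolp.

Set Implicit Arguments.
Unset Strict Implicit.
Unset Printing Implicit Defensive.

(* The letter (x, false) stands for x, and (x, true) for x^-1. *)
Definition letter (X : finType) : finType := (X * bool)%type.

Definition linv {X : finType} (a : letter X) : letter X := (a.1, ~~ a.2).

Lemma linvK (X : finType) : involutive (@linv X).
Proof. by case=> x b; rewrite /linv /= negbK. Qed.

Section FreeGroup.
Variable X : finType.
Implicit Types (a b : letter X) (u w : seq (letter X)).

Definition reduced_word w := sorted (fun a b => b != linv a) w.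

Definition push a w :=
  if w is b :: w' then if b == linv a then w' else a :: w else [:: a].

(* If w is reduced, then [wmul u w] is the reduced form of u ++ w. *)
Definition wmul u w := foldr push w u.

Lemma push_reduced a w : reduced_word w -> reduced_word (push a w).
Proof.
case: w => [|b w] //= pw; case: eqP => [_|/eqP nb] /=; last by rewrite nb pw.
exact: path_sorted pw.
Qed.

Lemma wmul_reduced u w : reduced_word w -> reduced_word (wmul u w).
Proof. by move=> rw; elim: u => //= a u; apply: push_reduced. Qed.

Lemma pushK a w : reduced_word w -> push a (push (linv a) w) = w.
Proof.
case: w => [|b w] /=; first by rewrite eqxx.
rewrite linvK; case: (b =P a) => [->|_] /=; last by rewrite eqxx.
by case: w => [|c w] //= /andP[/negPf->].
Qed.

Lemma wmul_push a u w : reduced_word w ->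
  wmul (push a u) w = push a (wmul u w).
Proof.
move=> rw; case: u => [|b u] //=; case: eqP => [->|//].
by rewrite pushK // wmul_reduced.
Qed.

Lemma wmulA u v w : reduced_word w -> wmul u (wmul v w) = wmul (wmul u v) w.
Proof. by move=> rw; elim: u => //= a u ->; rewrite wmul_push. Qed.

Lemma wmulw1 w : reduced_word w -> wmul w [::] = w.
Proof.
elim: w => //= a w IH pw; rewrite (IH (path_sorted pw)).
by case: w pw {IH} => //= b w /andP[/negPf->].
Qed.

Definition winv w := rev (map linv w).

Lemma winv_reduced w : reduced_word w -> reduced_word (winv w).
Proof.
rewrite /reduced_word /winv rev_sorted sorted_map.
apply: sub_sorted => a b /=; apply: contra => /eqP ->.
by rewrite linvK.
Qed.

Lemma winvK : involutive winv.
Proof.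
move=> w; rewrite /winv map_rev revK -map_comp -[RHS]map_id.
by apply: eq_map => a /=; rewrite linvK.
Qed.

Lemma wmulVw w : wmul (winv w) w = [::].
Proof.
elim: w => //= a w IH; rewrite /winv /= rev_cons /wmul foldr_rcons /=.
by rewrite linvK eqxx.
Qed.

Lemma wmulwV w : wmul w (winv w) = [::].
Proof. by rewrite -{1}[w]winvK wmulVw. Qed.

Record freeGroup := FreeGroup { fword :> seq (letter X); _ : reduced_word fword }.

HB.instance Definition _ := [isSub for fword].
HB.instance Definition _ := [Choice of freeGroup by <:].

Lemma fwordP (w : freeGroup) : reduced_word w. Proof. exact: valP. Qed.

Definition fg_one : freeGroup := @FreeGroup [::] isT.
Definition fg_mul (u w : freeGroup) : freeGroup :=
  FreeGroup (wmul_reduced u (fwordP w)).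
Definition fg_inv (w : freeGroup) : freeGroup :=
  FreeGroup (winv_reduced (fwordP w)).

Fact fg_mulA : associative fg_mul.
Proof. by move=> u v w; apply: val_inj; rewrite /= wmulA ?fwordP. Qed.
Fact fg_mul1w : left_id fg_one fg_mul.
Proof. by move=> w; apply: val_inj. Qed.
Fact fg_mulw1 : right_id fg_one fg_mul.
Proof. by move=> w; apply: val_inj; rewrite /= wmulw1 ?fwordP. Qed.
Fact fg_mulVw : left_inverse fg_one fg_inv fg_mul.
Proof. by move=> w; apply: val_inj; rewrite /= wmulVw. Qed.
Fact fg_mulwV : right_inverse fg_one fg_inv fg_mul.
Proof. by move=> w; apply: val_inj; rewrite /= wmulwV. Qed.

HB.instance Definition _ :=
  isGroup.Build freeGroup fg_mulA fg_mul1w fg_mulw1 fg_mulVw fg_mulwV.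

Definition fgen (x : X) : freeGroup := @FreeGroup [:: (x, false)] isT.

End FreeGroup.

(* A finite group K with a fixed surjective homomorphism F -> K; for w in F,
   [gval_of K w] is [w]_K. *)
Record finGenGroup (X : finType) := FinGenGroup {
  gg_sort :> finGroupType;
  gval_of : {multiplicative freeGroup X -> gg_sort};
  gval_of_surj : forall g : gg_sort, exists w, gval_of w = g
}.

Record lgraph (X : finType) := LGraph {
  vert : finType;
  edge : finType;
  ialpha : edge -> vert;
  iomega : edge -> vert;
  erev : edge -> edge;
  elabel : edge -> letter X;
  erev_neq : forall e, erev e != e;
  erevK : involutive erev;
  ialpha_rev : forall e, ialpha (erev e) = iomega e;
  iomega_rev : forall e, iomega (erev e) = ialpha e;
  elabel_rev : forall e, elabel (erev e) = linv (elabel e)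
}.

Section Graphs.
Variable X : finType.
Implicit Type D : lgraph X.

Fixpoint path_from D (v : vert D) (p : seq (edge D)) : bool :=
  if p is e :: p' then (ialpha e == v) && path_from (iomega e) p' else true.

Definition path_end D (v : vert D) (p : seq (edge D)) : vert D :=
  last v (map (@iomega X D) p).

(* The initial vertex is recorded separately to allow for empty paths. *)
Record gpath D := GPath {
  palpha : vert D;
  pedges : seq (edge D);
  pathP_of : path_from palpha pedges
}.

Definition pomega D (p : gpath D) : vert D := path_end (palpha p) (pedges p).

Definition plabel D (p : gpath D) : seq (letter X) :=
  map (@elabel X D) (pedges p).

Definition reduced_path D (p : gpath D) : bool :=
  sorted (fun e f => f != erev e) (pedges p).

Definition traverses D (p : gpath D) (e : edge D) : bool :=
  (e \in pedges p) || (erev e \in pedges p).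

Definition immersion D : Prop :=
  forall (v : vert D) (a : letter X) (e f : edge D),
    ialpha e = v -> elabel e = a -> ialpha f = v -> elabel f = a -> e = f.

Definition covering D : Prop :=
  forall (v : vert D) (a : letter X),
    exists! e : edge D, ialpha e = v /\ elabel e = a.

(* Containment is taken up to isomorphism: D embeds in D'. *)
Definition labelled_subgraph (D D' : lgraph X) : Prop :=
  exists (fv : vert D -> vert D') (fe : edge D -> edge D'),
    [/\ injective fv, injective fe,
        forall e, ialpha (fe e) = fv (ialpha e) /\
                  iomega (fe e) = fv (iomega e),
        forall e, fe (erev e) = erev (fe e) &
        forall e, elabel (fe e) = elabel e].

Definition covering_expansion (D D' : lgraph X) : Prop :=
  covering D' /\ labelled_subgraph D D'.

End Graphs.

(* The edge (g, x, false) is the edge labelled x from g to g[x]_K, and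
   (g, x, true) is its reverse. *)
Section Cayley.
Variables (X : finType) (K : finGenGroup X).

Definition cayley_edge : finType := (K * X * bool)%type.
Definition cayley_end (e : cayley_edge) (b : bool) : K :=
  if b then (e.1.1 * gval_of K (fgen e.1.2))%g else e.1.1.
Definition cayley_rev (e : cayley_edge) : cayley_edge := (e.1, ~~ e.2).
Definition cayley_label (e : cayley_edge) : letter X := (e.1.2, e.2).

Fact cayley_rev_neq e : cayley_rev e != e.
Proof. by case: e => [[g x] []]; rewrite -pair_eqE /= andbF. Qed.
Fact cayley_revK : involutive cayley_rev.
Proof. by case=> [[g x] b]; rewrite /cayley_rev /= negbK. Qed.

Definition cayley_graph : lgraph X :=
  @LGraph X K cayley_edge
    (fun e => cayley_end e e.2) (fun e => cayley_end e (~~ e.2))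
    cayley_rev cayley_label
    cayley_rev_neq cayley_revK
    (fun e => erefl)
    (fun e => congr1 (cayley_end e) (negbK e.2))
    (fun e => erefl).

End Cayley.

Section Deck.
Variables (X : finType) (D : lgraph X) (covD : covering D).
Implicit Types (v : vert D) (a : letter X) (w : seq (letter X)).

Lemma covering_immersion : immersion D.
Proof.
move=> v a e f ev ea fv fa; have [g [_ ug]] := covD v a.
by rewrite -(ug e) // -(ug f).
Qed.

Lemma path_with_label_ex v w :
  exists p : seq (edge D), path_from v p && (map (@elabel X D) p == w).
Proof.
elim: w v => [|a w IH] v; first by exists [::].
have [e [[ev ea] _]] := covD v a; have [p /andP[pp /eqP pw]] := IH (iomega e).
by exists (e :: p); rewrite /= ev ea pp pw !eqxx.
Qed.

Lemma path_with_label_uniq v (p q : seq (edge D)) :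
  path_from v p -> path_from v q ->
  map (@elabel X D) p = map (@elabel X D) q -> p = q.
Proof.
elim: p v q => [|e p IH] v [|f q] //= /andP[/eqP ev pp] /andP[/eqP fv pq].
case=> ef epq; have E : e = f by apply: covering_immersion ev ef fv erefl.
by rewrite -E; congr cons; apply: IH pp _ epq; rewrite E.
Qed.

Definition deck_act v w : vert D := path_end v (xchoose (path_with_label_ex v w)).

Lemma deck_actE v (p : seq (edge D)) : path_from v p ->
  deck_act v (map (@elabel X D) p) = path_end v p.
Proof.
move=> pp; rewrite /deck_act; congr path_end.
have /andP[qq /eqP] := xchooseP (path_with_label_ex v (map (@elabel X D) p)).
exact: (path_with_label_uniq qq pp).
Qed.

Lemma deck_act_cons v (e : edge D) w : ialpha e = v ->
  deck_act v (elabel e :: w) = deck_act (iomega e) w.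
Proof.
move=> ev; have [p /andP[pp /eqP <-]] := path_with_label_ex (iomega e) w.
by rewrite (deck_actE pp) -map_cons deck_actE //= ev eqxx.
Qed.

Lemma deck_act_nil v : deck_act v [::] = v.
Proof. exact: (@deck_actE v [::]). Qed.

Lemma deck_act_push v a w : deck_act v (push a w) = deck_act v (a :: w).
Proof.
case: w => [|b w] //=; case: eqP => // ->.
have [e [[ev <-] _]] := covD v a.
rewrite deck_act_cons // -elabel_rev deck_act_cons ?ialpha_rev //.
by rewrite iomega_rev ev.
Qed.

Lemma deck_act_wmul v u w : deck_act v (wmul u w) = deck_act (deck_act v u) w.
Proof.
elim: u v => [|a u IH] v /=; first by rewrite deck_act_nil.
rewrite deck_act_push; have [e [[ev <-] _]] := covD v a.
by rewrite !deck_act_cons.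
Qed.

Lemma deck_act_inj (w : freeGroup X) : injective (fun v => deck_act v w).
Proof.
apply: (can_inj (g := fun v => deck_act v (winv w))) => v /=.
by rewrite -deck_act_wmul wmulwV deck_act_nil.
Qed.

Definition deck_perm (w : freeGroup X) : {perm vert D} := perm (@deck_act_inj w).

(* In {perm _}, (s * t) v = t (s v), i.e. permutations compose as right actions. *)
Lemma deck_permM : {morph deck_perm : u w / (u * w)%g}.
Proof. by move=> u w; apply/permP => v; rewrite permM !permE deck_act_wmul. Qed.

Definition deck_set : {set {perm vert D}} :=
  [set s | `[< exists w : freeGroup X, deck_perm w = s >]].

Lemma deck_permP (w : freeGroup X) : deck_perm w \in deck_set.
Proof. by rewrite inE; apply/asboolP; exists w. Qed.

Fact deck_set_group : group_set deck_set.
Proof.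
apply/group_setP; split=> [|s t].
  suff <- : deck_perm 1%g = 1%g by apply: deck_permP.
  by apply/permP => v; rewrite permE perm1 deck_act_nil.
rewrite 2!inE => /asboolP[u <-] /asboolP[w <-].
by rewrite -deck_permM deck_permP.
Qed.

Definition deck_gset : {group {perm vert D}} := Group deck_set_group.

Definition deck_map (w : freeGroup X) : [subg deck_gset] :=
  @Subg _ deck_gset (deck_perm w) (deck_permP w).

Fact deck_mapM : {morph deck_map : u w / (u * w)%g}.
Proof. by move=> u w; apply: val_inj; apply: deck_permM. Qed.

HB.instance Definition _ :=
  isMultiplicative.Build (freeGroup X) [subg deck_gset] deck_map deck_mapM.

Fact deck_map_surj (g : [subg deck_gset]) : exists w : freeGroup X, deck_map w = g.
Proof.
case: g => s sG; have /asboolP[w ws] : `[< exists w : freeGroup X, deck_perm w = s >].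
  by have := sG; rewrite inE.
by exists w; apply: val_inj.
Qed.

Definition deck_group : finGenGroup X :=
  @FinGenGroup X [subg deck_gset] deck_map deck_map_surj.

End Deck.

(* Main.v *)
Require Import Defs.
From mathcomp Require Import all_boot all_fingroup.

Set Implicit Arguments.
Unset Strict Implicit.
Unset Printing Implicit Defensive.

(** The homomorphism [phi] turns the Cayley graph of [H] into a graph over the
    covering: fixing [g0] in [H] and a vertex [v0] of the covering, the map
    [h |-> v0 . phi (g0^-1 h)] respects labelled edges.  Taking [g0] and [v0]
    to be the initial vertices of [eta'] and [gam'], it sends [eta'] onto
    [gam'], so every geometric edge traversed by [eta'], hence every edge of
    [eta], is sent into [Gam]; the image of [eta] is the required path. *)

Lemma multiplicative_group1 (G K : groupType) (f : {multiplicative G -> K}) :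
  f 1%g = 1%g.
Proof. by apply: (mulgI (f 1%g)); rewrite -gmulfM !mulg1. Qed.

Section CayleyToCovering.
Variables (X : finType) (D : lgraph X) (covD : covering D) (H : finGenGroup X).
Variable phi : {multiplicative H -> deck_group covD}.
Hypothesis phiE : forall w : freeGroup X,
  gval_of (deck_group covD) w = phi (gval_of H w).
Variables (g0 : H) (v0 : vert D).

Definition cayley_vmap (h : H) : vert D :=
  @sgval _ (deck_gset covD) (phi (g0^-1 * h)%g) v0.

Lemma cayley_vmap_base : cayley_vmap g0 = v0.
Proof. by rewrite /cayley_vmap mulVg multiplicative_group1 perm1. Qed.

(** Left translation by [g0^-1] commutes with right multiplication by [gval_of H w], and [phi] sends
    the latter factor to the deck permutation of [w]. *)
Lemma cayley_vmapM (h : H) (w : freeGroup X) :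
  cayley_vmap (h * gval_of H w)%g = deck_act covD (cayley_vmap h) w.
Proof. by rewrite /cayley_vmap mulgA gmulfM -phiE /= permM permE. Qed.

Lemma cayley_vmap_edge (e : edge (cayley_graph H)) :
  cayley_vmap (iomega e) = deck_act covD (cayley_vmap (ialpha e)) [:: elabel e].
Proof.
case: e => [[g x] [] /=]; rewrite /cayley_end /= cayley_vmapM //.
(* What remains is the reverse edge, from [g * [x]] to [g]: acting by [x] and then by [x^-1] is
   trivial. *)
by rewrite -deck_act_wmul /= eqxx deck_act_nil.
Qed.

End CayleyToCovering.

Section LiftToSubgraph.
Variables (X : finType) (C Gam : lgraph X) (T : Type).
Variables (F : vert C -> T) (fv : vert Gam -> T).

(** [F] acts on vertices only, so a lift is recorded by its two ends and its label; this suffices to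
    reassemble labelled paths. *)
Definition edge_lifts (e : edge C) : Prop :=
  exists f : edge Gam, [/\ fv (ialpha f) = F (ialpha e),
    fv (iomega f) = F (iomega e) & elabel f = elabel e].

Lemma edge_lifts_rev (e : edge C) : edge_lifts e -> edge_lifts (erev e).
Proof.
case=> f [fa fo fl]; exists (erev f).
by rewrite !ialpha_rev !iomega_rev !elabel_rev fl.
Qed.

Lemma traverses_lifts (p : gpath C) (e : edge C) :
  (forall d, d \in pedges p -> edge_lifts d) -> traverses p e -> edge_lifts e.
Proof.
move=> lp /orP[/lp //|/lp /edge_lifts_rev].
by rewrite erevK.
Qed.

(** The lifts of successive edges are chosen independently; they meet because their ends agree under
    [fv], which is injective. *)
Lemma lift_path (h : vert C) (v : vert Gam) (p : seq (edge C)) :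
    injective fv -> fv v = F h -> path_from h p ->
    (forall e, e \in p -> edge_lifts e) ->
  exists q : seq (edge Gam), [/\ path_from v q,
    map (@elabel X Gam) q = map (@elabel X C) p &
    fv (path_end v q) = F (path_end h p)].
Proof.
move=> fv_inj; elim: p h v => [|e p IH] h v vh /=; first by exists [::].
move=> /andP[/eqP eh pp] lp.
have [f [fa fo fl]] := lp e (mem_head _ _).
have lp' d : d \in p -> edge_lifts d by move=> dp; apply: lp; rewrite inE dp orbT.
have [q [qp ql qe]] := IH _ _ fo pp lp'.
exists (f :: q); split=> //=; last by rewrite fl ql.
by rewrite qp andbT; apply/eqP/fv_inj; rewrite fa eh vh.
Qed.

End LiftToSubgraph.

(** In a covering, the start and the label of an edge determine its end. By induction [p] and [q]
    therefore stay over the same vertices, and each edge of [q] lifts the corresponding edge of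
    [p]. *)
Lemma path_edges_lift (X : finType) (C Gam D : lgraph X) (covD : covering D)
    (F : vert C -> vert D) (fv : vert Gam -> vert D)
    (h : vert C) (v : vert Gam) (p : seq (edge C)) (q : seq (edge Gam)) :
    (forall e, F (iomega e) = deck_act covD (F (ialpha e)) [:: elabel e]) ->
    (forall f, fv (iomega f) = deck_act covD (fv (ialpha f)) [:: elabel f]) ->
    fv v = F h -> path_from h p -> path_from v q ->
    map (@elabel X Gam) q = map (@elabel X C) p ->
  (forall e, e \in p -> edge_lifts F fv e) /\
  fv (path_end v q) = F (path_end h p).
Proof.
move=> Fe fve; elim: p h v q => [|e p IH] h v [|f q] //= vh.
move=> /andP[/eqP eh pp] /andP[/eqP fv_v qq] [fl ql].
have fo : fv (iomega f) = F (iomega e) by rewrite Fe fve fl eh fv_v vh.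
have [lp ends] := IH _ _ _ fo pp qq ql; split=> // d.
rewrite inE => /predU1P[->|/lp //].
by exists f; rewrite eh fv_v.
Qed.

Lemma subgraph_deck_act (X : finType) (Gam D : lgraph X) (covD : covering D)
    (fv : vert Gam -> vert D) (fe : edge Gam -> edge D) (f : edge Gam) :
    (forall e, ialpha (fe e) = fv (ialpha e) /\ iomega (fe e) = fv (iomega e)) ->
    (forall e, elabel (fe e) = elabel e) ->
  fv (iomega f) = deck_act covD (fv (ialpha f)) [:: elabel f].
Proof.
move=> ends lab; have [<- <-] := ends f.
by rewrite -lab deck_act_cons // deck_act_nil.
Qed.

Theorem lemma2p1 (X : finType) (Gam Gamp : lgraph X)
  (himm : immersion Gam)
  (hexp : covering_expansion Gam Gamp)
  (H : finGenGroup X)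
  (phi : {multiplicative H -> deck_group (proj1 hexp)})
  (hphi : forall w : freeGroup X,
     gval_of (deck_group (proj1 hexp)) w = phi (gval_of H w))
  (eta eta' : gpath (cayley_graph H))
  (heta : reduced_path eta) (heta' : reduced_path eta')
  (halpha : palpha eta = palpha eta')
  (htrav : forall e : edge (cayley_graph H), traverses eta e -> traverses eta' e)
  (gam' : gpath Gam) (hgam' : reduced_path gam')
  (hlab : plabel gam' = plabel eta') :
  exists gam : gpath Gam,
    [/\ plabel gam = plabel eta,
        palpha gam = palpha gam' &
        pomega eta = pomega eta' -> pomega gam = pomega gam'].
Proof.
have [fv [fe [fv_inj _ ends _ lab]]] := proj2 hexp.
pose F : vert (cayley_graph H) -> vert Gamp :=
  cayley_vmap phi (palpha eta') (fv (palpha gam')).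
have base : fv (palpha gam') = F (palpha eta') by rewrite /F cayley_vmap_base.
have [lifts' end'] := path_edges_lift (cayley_vmap_edge hphi _ _)
  (fun f => subgraph_deck_act (proj1 hexp) f ends lab)
  base (pathP_of eta') (pathP_of gam') hlab.
have lifts e : e \in pedges eta -> edge_lifts F fv e.
  by move=> ep; apply: (traverses_lifts lifts'); apply: htrav; rewrite /traverses ep.
rewrite -halpha in base.
have [q [qp ql qe]] := lift_path fv_inj base (pathP_of eta) lifts.
exists (GPath qp); split=> // same_end.
(* Under [fv] both end vertices become the image by [F] of the common end of [eta] and [eta']. *)
by apply: fv_inj; rewrite /pomega /= qe end' -/(pomega eta) same_end.
Qed.
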